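(* Let $f:[0,\infty)\to\mathbb{R}$ belong to $SX((h-s)_1,I)$ with $I=[0,\infty)$, and let $g:[0,\infty)\to[0,\infty)$ be a linear function. Then the composition $f\circ g$ is $(h-s)_1$-convex on $I$.
   Context: Let $J\subseteq\mathbb{R}$ with $[0,1]\subseteq J$, let $h:J\to\mathbb{R}$ be a nonnegative function with $h\not\equiv 0$, and let $s\in(0,1]$. Write $h^s(t)=(h(t))^s$, and let $I=[0,\infty)$. A function $f:[0,\infty)\to\mathbb{R}$ is $(h-s)_1$-convex on $I$ (in the first sense), written $f\in SX((h-s)_1,I)$, if $f$ is nonnegative and for all $x,y\in I$ and $t\in[0,1]$, $$f(tx+(1-t)y)\le h^s(t)f(x)+(1-h^s(t))f(y).$$ *)

(* Defs.v *)
From HB Require Import structures.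
From mathcomp Require Import all_boot all_order all_algebra.
From mathcomp Require Import all_classical all_reals all_analysis.

Set Implicit Arguments.
Unset Strict Implicit.
Unset Printing Implicit Defensive.

Import Order.TTheory GRing.Theory Num.Theory.

Local Open Scope classical_set_scope.
Local Open Scope ring_scope.

(* A function defined on a subset of R is represented by a total function
   R -> R of which only the values on that subset are ever constrained. *)

Definition nonneg_halfline (R : realType) : set R := `[0, +oo[.

(* f \in SX((h-s)_1, I).  For s > 0, 0 `^ s = 0, so [h t `^ s] is the usual
   real power even where h vanishes. *)
Definition hs1_convex (R : realType) (h : R -> R) (s : R) (I : set R)
    (f : R -> R) : Prop :=
  (forall x, I x -> 0 <= f x) /\
  (forall x y t, I x -> I y -> 0 <= t <= 1 ->
     f (t * x + (1 - t) * y) <= h t `^ s * f x + (1 - h t `^ s) * f y).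

(* "Linear function" of one real variable in the sense of an expression
   a x + b; the homogeneous case is b = 0. *)
Definition linear_function_on (R : realType) (I : set R) (g : R -> R) : Prop :=
  exists a b : R, forall x, I x -> g x = a * x + b.

(* Main.v *)
Require Import Defs.
From HB Require Import structures.
From mathcomp Require Import all_boot all_order all_algebra.
From mathcomp Require Import all_classical all_reals all_analysis.
From mathcomp Require Import ring.

Set Implicit Arguments.
Unset Strict Implicit.
Unset Printing Implicit Defensive.

Import Order.TTheory GRing.Theory Num.Theory.

Local Open Scope classical_set_scope.
Local Open Scope ring_scope.

(** An affine map commutes with convex combinations,
    [g (t x + (1 - t) y) = t g x + (1 - t) g y], because the weights [t] and
    [1 - t] sum to [1].  Hence the inequality for [f \o g] at [x], [y] is the
    inequality for [f] at [g x], [g y].  As [g] is only known to be affine on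
    the half-line, the convex combination must be shown to stay there. *)

Lemma nonneg_halfline_conv (R : realType) (x y t : R) :
  nonneg_halfline x -> nonneg_halfline y -> 0 <= t <= 1 ->
  nonneg_halfline (t * x + (1 - t) * y).
Proof.
rewrite /nonneg_halfline /= !in_itv /= !andbT => x0 y0 /andP[t0 t1].
by rewrite addr_ge0 ?mulr_ge0 ?subr_ge0.
Qed.

Lemma linear_function_on_conv (R : realType) (I : set R) (g : R -> R)
    (x y t : R) :
  linear_function_on I g -> I x -> I y -> I (t * x + (1 - t) * y) ->
  g (t * x + (1 - t) * y) = t * g x + (1 - t) * g y.
Proof. by move=> [a [b gE]] Ix Iy Ixy; rewrite !gE//; ring. Qed.

Theorem theorem2p1 (R : realType) (J : set R) (h : R -> R) (s : R)
    (f g : R -> R)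
    (J01 : `[0, 1] `<=` J)
    (h_ge0 : forall t, J t -> 0 <= h t)
    (h_neq0 : exists2 t, J t & h t != 0)
    (s01 : 0 < s <= 1)
    (f_convex : hs1_convex h s (@nonneg_halfline R) f)
    (g_maps : forall x, nonneg_halfline x -> nonneg_halfline (g x))
    (g_linear : linear_function_on (@nonneg_halfline R) g) :
  hs1_convex h s (@nonneg_halfline R) (f \o g).
Proof.
have [f_ge0 f_le] := f_convex.
split=> [x Ix|x y t Ix Iy t01] /=; first exact/f_ge0/g_maps.
rewrite (linear_function_on_conv g_linear)//; last exact: nonneg_halfline_conv.
by apply: f_le => //; exact: g_maps.
Qed.
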